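(* Let $q$ be a prime power, let $m,k$ be positive integers and let $s\in\{1,\ldots,m\}$ with $\gcd(s,m)=1$. Let $S,T\subseteq\mathbb{F}_{q^m}$ be $\mathbb{F}_q$-subspaces with $\dim_{\mathbb{F}_q}(S)=\dim_{\mathbb{F}_q}(T)>k$. Then the $q$-systems $G_{k,s,m}[S]$ and $G_{k,s,m}[T]$ are equivalent if and only if there exists $\alpha\in\mathbb{F}_{q^m}^*$ such that $T=\alpha S$. In particular, when $m>k$ (so that $S=T=\mathbb{F}_{q^m}$ satisfies the hypothesis), \[ \mathrm{stab}_{\mathrm{GL}(k,q^m)}(G_{k,s,m})=\left\{\mathrm{diag}\big(d,d^{q^s},d^{q^{2s}},\ldots,d^{q^{s(k-1)}}\big)\,:\,d\in\mathbb{F}_{q^m}^*\right\}. \]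
   Context: For an $\mathbb{F}_q$-subspace $S\subseteq\mathbb{F}_{q^m}$, the Gabidulin system is $G_{k,s,m}[S]=\{(x,x^{q^s},\ldots,x^{q^{s(k-1)}}):x\in S\}\subseteq\mathbb{F}_{q^m}^k$, an $\mathbb{F}_q$-subspace, and $G_{k,s,m}:=G_{k,s,m}[\mathbb{F}_{q^m}]$. Elements of $\mathbb{F}_{q^m}^k$ are treated as column vectors when multiplied by matrices. Two such $\mathbb{F}_q$-subspaces $\mathcal{U},\mathcal{V}\subseteq\mathbb{F}_{q^m}^k$ are equivalent if there is $A\in\mathrm{GL}(k,q^m)$ with $A\mathcal{U}=\{Au:u\in\mathcal{U}\}=\mathcal{V}$; the stabilizer $\mathrm{stab}_{\mathrm{GL}(k,q^m)}(\mathcal{U})$ is the set of $A\in\mathrm{GL}(k,q^m)$ with $A\mathcal{U}=\mathcal{U}$. *)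

(* Defs.v *)
From HB Require Import structures.
From mathcomp Require Import all_boot all_order all_algebra all_field.
From mathcomp Require Import boolp classical_sets.

Set Implicit Arguments.
Unset Strict Implicit.
Unset Printing Implicit Defensive.

Import GRing.Theory.
Local Open Scope ring_scope.
Local Open Scope classical_set_scope.

(* F plays the role of F_q, so q = #|F|, and L that of F_{q^m}, so
   m = \dim {:L}. Systems are subsets of the column space L^k: 'cV[L]_k
   carries a canonical vector space structure over L only, not over F. *)

Definition gabidulin_vec (F : finFieldType) (L : fieldExtType F)
    (k s : nat) (x : L) : 'cV[L]_k :=
  \col_(i < k) x ^+ (#|F| ^ (s * i)).

Definition gabidulin_system (F : finFieldType) (L : fieldExtType F)
    (k s : nat) (S : {vspace L}) : set 'cV[L]_k :=
  gabidulin_vec k s @` [set x | x \in S].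
Arguments gabidulin_system {F L} k s S _.

Definition system_equiv (L : fieldType) (k : nat) (U V : set 'cV[L]_k) : Prop :=
  exists2 A : 'M[L]_k, A \in unitmx & [set A *m u | u in U] = V.

Definition system_stab (L : fieldType) (k : nat) (U : set 'cV[L]_k) :
    set 'M[L]_k :=
  [set A | A \in unitmx /\ [set A *m u | u in U] = U].

(* Main.v *)
Require Import Defs.
From HB Require Import structures.
From mathcomp Require Import all_boot all_order all_algebra all_field.
From mathcomp Require Import boolp classical_sets.

Set Implicit Arguments.
Unset Strict Implicit.
Unset Printing Implicit Defensive.

Import GRing.Theory.
Local Open Scope ring_scope.
Local Open Scope classical_set_scope.

(** Write [sigma x = x^(q^s)]. As [gcd(s, m) = 1], the fixed field of [sigma] is
    [F_q], so a nonzero sigma-polynomial of sigma-degree at most [k] has a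
    kernel of [F_q]-dimension at most [k].
    If [A] maps [G[S]] into a Gabidulin system, then on [S] row [i+1] of [A] is
    the [sigma]-image of row [i]; the difference is a sigma-polynomial of
    sigma-degree at most [k] vanishing on [S], hence it is zero. Thus
    [a_(i+1,j+1) = sigma (a_(i,j))], while [a_(i+1,0)] and [a_(i,k-1)] vanish,
    which forces [A = diag(d, sigma d, sigma^2 d, ...)]; such a matrix sends
    [G[S]] to [G[d S]]. *)

Section FrobeniusPower.

Variables (F : finFieldType) (L : fieldExtType F).
Implicit Types (x y : L) (s : nat).

Definition frobenius_pow s x : L := x ^+ (#|F| ^ s).

Lemma frobenius_powM s : {morph frobenius_pow s : x y / x * y}.
Proof. by move=> x y; rewrite /frobenius_pow exprMn. Qed.

Lemma frobenius_powD s : {morph frobenius_pow s : x y / x + y}.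
Proof.
move=> x y; apply: exprDn_pchar.
have [p p_pr pF] := finPcharP F.
have pL : p \in [pchar L] by rewrite pchar_lalg.
(* The exponent [#|F| ^ s] is a power of the characteristic [p], so raising to it is additive. *)
rewrite (eq_pnat _ (pcharf_eq pL)) (card_pprimeChar pF) -expnM.
by rewrite pnatX pnat_id.
Qed.

Lemma frobenius_pow_eq0 s x : (frobenius_pow s x == 0) = (x == 0).
Proof.
by rewrite /frobenius_pow expf_eq0 expn_gt0 (ltnW (finNzRing_gt1 F)).
Qed.

Lemma frobenius_pow0 s : frobenius_pow s 0 = 0.
Proof. by apply/eqP; rewrite frobenius_pow_eq0. Qed.

Lemma frobenius_pow_comp s t x :
  frobenius_pow s (frobenius_pow t x) = frobenius_pow (t + s) x.
Proof. by rewrite /frobenius_pow -exprM -expnD. Qed.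

Lemma frobenius_powZ s (a : F) x :
  frobenius_pow s (a *: x) = a *: frobenius_pow s x.
Proof.
rewrite /frobenius_pow exprZn; congr (_ *: _).
by elim: s => // s IHs; rewrite expnSr exprM IHs expf_card.
Qed.

Lemma frobenius_pow_is_linear s : linear (frobenius_pow s).
Proof. by move=> a x y; rewrite frobenius_powD frobenius_powZ. Qed.

HB.instance Definition _ s := GRing.isSemilinear.Build F L L _ (frobenius_pow s)
  (GRing.semilinear_linear (frobenius_pow_is_linear s)).

(** Every element is also fixed by the power [m = \dim {:L}] of the [q]-Frobenius, so Bezout makes
    [x] fixed by the power [gcd(s, m) = 1], that is, [x ^+ q = x]. *)
Lemma frobenius_pow_fixed s x : coprime s (\dim {:L}) ->
  frobenius_pow s x = x -> x \in 1%VS.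
Proof.
move=> co_sm fix_s.
have fixM n t : frobenius_pow t x = x -> frobenius_pow (n * t) x = x.
  move=> fix_t; elim: n => [|n IHn]; first by rewrite mul0n /frobenius_pow expr1.
  by rewrite mulSn -frobenius_pow_comp fix_t.
have fix_m : frobenius_pow (\dim {:L}) x = x.
  by apply/eqP; rewrite -Fermat's_little_theorem memvf.
suff fix_1 : frobenius_pow 1 x = x.
  by rewrite (Fermat's_little_theorem 1%AS) dimv1; apply/eqP.
(* For [s = 0] coprimality forces [m = 1], and [fix_m] is already the goal. *)
have [s0|s_gt0] := posnP s.
  by move: co_sm fix_m; rewrite s0 /coprime gcd0n => /eqP->.
(* Bezout over the naturals, [u * s = v * m + 1]: first replace [x] by its image under the power
   [v * m]. *)
case: (egcdnP (\dim {:L}) s_gt0) => u v def_us _.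
rewrite -[in LHS](fixM v _ fix_m) frobenius_pow_comp -(eqP co_sm) -def_us.
exact: fixM.
Qed.

End FrobeniusPower.

(** With [y j] the [j]-th iterate of [sigma], this is right division by [sigma - 1]: the quotient
    has the negated partial sums as coefficients, and the remainder is the total sum. *)
Lemma summation_by_parts (R : pzRingType) (d y : nat -> R) n :
  \sum_(j < n) (- \sum_(i < j.+1) d i) * (y j.+1 - y j) =
  \sum_(i < n) d i * y i - (\sum_(i < n) d i) * y n.
Proof.
elim: n => [|n IHn]; first by rewrite !big_ord0 mul0r subrr.
rewrite [LHS]big_ord_recr /= IHn [\sum_(i < n.+1) d i * _]big_ord_recr /=.
rewrite [\sum_(i < n.+1) d i]big_ord_recr /= -addrA -[RHS]addrA; congr (_ + _).
by rewrite mulNr mulrBr opprB mulrDl addrA addKr.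
Qed.

Section GabidulinSystems.

Variables (F : finFieldType) (L : fieldExtType F) (s : nat).
Hypothesis co_sm : coprime s (\dim {:L}).
Local Notation sigma := (@frobenius_pow F L).

(** Rank-nullity: the kernel of [sigma - 1] is contained in the line [1%VS]. *)
Lemma dim_frobenius_sub_id (S : {vspace L}) :
  (\dim S <= (\dim ((linfun (sigma s) - \1)%VF @: S)%VS).+1)%N.
Proof.
rewrite -(limg_ker_dim (linfun (sigma s) - \1)%VF S) -[X in (_ <= X)%N]add1n.
rewrite leq_add2r.
have <- : \dim (1%VS : {vspace L}) = 1%N by rewrite dimv1.
apply/dimvS/subvP => x; rewrite memv_cap memv_ker => /andP[_].
rewrite !lfun_simp subr_eq0 => /eqP.
exact: frobenius_pow_fixed.
Qed.

(* After rescaling so that 1 is a root, the polynomial is right-divisible by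
   [sigma - 1], and [sigma - 1] lowers the dimension of the kernel by one. *)
Lemma sigma_poly_eq0 k (S : {vspace L}) (c : nat -> L) :
  (k < \dim S)%N ->
  {in S, forall x, \sum_(i < k.+1) c i * sigma (s * i) x = 0} ->
  forall i, (i <= k)%N -> c i = 0.
Proof.
elim: k S c => [|k IHk] S c dimS cS0.
  move=> i; rewrite leqn0 => /eqP->.
  have S_neq0 : S != 0%VS by rewrite -dimv_eq0 -lt0n.
  move: (cS0 _ (memv_pick S)); rewrite big_ord_recl big_ord0 addr0 muln0.
  move/eqP; rewrite mulf_eq0 frobenius_pow_eq0 vpick0 (negPf S_neq0) orbF.
  by move/eqP.
set u := vpick S.
have u_neq0 : u != 0 by rewrite vpick0 -dimv_eq0 -lt0n (leq_ltn_trans _ dimS).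
pose S1 := (amull (u^-1)%R @: S)%VS.
have dimS1 : \dim S1 = \dim S.
  apply: limg_dim_eq.
  by rewrite (eqP (lker0_amull _)) ?capv0 // unitfE invr_eq0.
have memS1 y : y \in S1 -> u * y \in S.
  by case/memv_imgP => x Sx ->; rewrite lfunE /= mulVKf.
have S1_1 : 1 \in S1.
  apply/memv_imgP; exists u; first exact: memv_pick.
  by rewrite lfunE /= mulVf.
(* Coefficients of the rescaled polynomial [y |-> P (u * y)], which vanishes on [S1], in particular
   at 1. *)
pose d i := c i * sigma (s * i) u.
have dS1 y : y \in S1 -> \sum_(i < k.+2) d i * sigma (s * i) y = 0.
  move=> /memS1/cS0 cuy; rewrite -[RHS]cuy; apply: eq_bigr => i _.
  by rewrite frobenius_powM mulrA.
have sum_d : \sum_(i < k.+2) d i = 0.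
  rewrite -[RHS](dS1 _ S1_1); apply: eq_bigr => i _.
  by rewrite /frobenius_pow expr1n mulr1.
(* These are the coefficients of the quotient by [sigma - 1]; it vanishes on the image of [S1],
   where the induction hypothesis applies. *)
have b0 j : (j <= k)%N -> - \sum_(i < j.+1) d i = 0.
  apply: (IHk ((linfun (sigma s) - \1)%VF @: S1)%VS (fun j => - \sum_(i < j.+1) d i)).
    by rewrite -ltnS (leq_trans _ (dim_frobenius_sub_id S1)) // dimS1.
  move=> _ /memv_imgP[y S1y ->]; rewrite !lfun_simp /=.
  transitivity (\sum_(j < k.+1) (- \sum_(i < j.+1) d i) *
                  (sigma (s * j.+1) y - sigma (s * j) y)).
    apply: eq_bigr => i _; congr (_ * _).
    by rewrite linearB /= frobenius_pow_comp mulnS.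
  rewrite (summation_by_parts d (fun j => sigma (s * j) y)).
  (* The sum of the first [k.+1] coefficients is minus the leading one, so the boundary term
     supplies the missing top term. *)
  move: sum_d; rewrite big_ord_recr /= => /eqP; rewrite addr_eq0 => /eqP->.
  by rewrite mulNr opprK -[RHS](dS1 y S1y) [RHS]big_ord_recr.
have D0 j : (j <= k.+2)%N -> \sum_(i < j) d i = 0.
  case: j => [|j]; first by rewrite big_ord0.
  rewrite ltnS leq_eqVlt => /predU1P[->//|].
  by rewrite ltnS => /b0/eqP; rewrite oppr_eq0 => /eqP.
move=> i le_ik; have := D0 i.+1 le_ik.
rewrite big_ord_recr /= D0 ?(leq_trans le_ik) // add0r => /eqP.
by rewrite mulf_eq0 frobenius_pow_eq0 (negPf u_neq0) orbF => /eqP.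
Qed.

Lemma gabidulin_map_diag k (S : {vspace L}) (A : 'M[L]_k) :
  (k < \dim S)%N ->
  {in S, forall x, exists y, A *m gabidulin_vec k s x = gabidulin_vec k s y} ->
  exists d, A = diag_mx (\row_(i < k) d ^+ (#|F| ^ (s * i))).
Proof.
case: k A => [|k] A dimS AS.
  by exists 0; apply/matrixP => -[].
(* Indexing by naturals lets rows and columns be shifted without casts; [inord] is only meaningful
   up to [k]. *)
pose a i j := A (inord i) (inord j).
have rowS x : x \in S -> forall i, (i < k)%N ->
    \sum_(j < k.+1) a i.+1 j * sigma (s * j) x =
    \sum_(j < k.+1) sigma s (a i j) * sigma (s * j.+1) x.
  move=> /AS[y /colP eqA] i lt_ik.
  have row l : (l <= k)%N ->
      \sum_(j < k.+1) a l j * sigma (s * j) x = sigma (s * l) y.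
    move=> le_lk; have := eqA (inord l); rewrite !mxE inordK //.
    rewrite -/(sigma (s * l) y) => <-.
    by apply: eq_bigr => j _; rewrite mxE /a inord_val.
  rewrite row // mulnS addnC -frobenius_pow_comp -(row i (ltnW lt_ik)) linear_sum /=.
  by apply: eq_bigr => j _; rewrite frobenius_powM frobenius_pow_comp addnC -mulnS.
(* Row [i.+1] has sigma-degrees 0 to [k], the image of row [i] has 1 to [k.+1]. Both are padded with
   zeros to a common range, whose top degree [k.+1] is still below [\dim S]. *)
have coefs i : (i < k)%N -> forall j, (j <= k.+1)%N ->
    (if (j <= k)%N then a i.+1 j else 0) =
    (if (0 < j)%N then sigma s (a i j.-1) else 0).
  move=> lt_ik j le_jk; apply/eqP; rewrite -subr_eq0; apply/eqP.
  move: j le_jk; apply: (sigma_poly_eq0 dimS) => x Sx.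
  under eq_bigr do rewrite mulrBl.
  rewrite sumrB big_ord_recr /= ltnn mul0r addr0 [X in _ - X]big_ord_recl.
  rewrite mul0r add0r; apply/eqP; rewrite subr_eq0; apply/eqP.
  rewrite -(rowS x Sx i lt_ik).
  by apply: eq_bigr => j _; rewrite -ltnS ltn_ord.
have a_shift i j : (i < k)%N -> (j < k)%N -> a i.+1 j.+1 = sigma s (a i j).
  by move=> lt_ik lt_jk; have := coefs i lt_ik j.+1 (ltnW lt_jk); rewrite lt_jk.
have a_first i : (i < k)%N -> a i.+1 0%N = 0.
  by move=> lt_ik; have := coefs i lt_ik 0%N isT.
have a_last i : (i < k)%N -> a i k = 0.
  move=> lt_ik; have := coefs i lt_ik k.+1 (leqnn _); rewrite ltnn /= => /esym/eqP.
  by rewrite frobenius_pow_eq0 => /eqP.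
(* Below the diagonal, follow the shift up and left to column 0. *)
have a_low j i : (j < i)%N -> (i <= k)%N -> a i j = 0.
  elim: j i => [|j IHj] [|i] // lt_ji lt_ik; first exact: a_first.
  have lt_jk : (j < k)%N by apply: ltn_trans lt_ik.
  by rewrite a_shift // IHj ?frobenius_pow0 // ltnW.
(* Above the diagonal, follow the shift down and right to column [k]; [t] is the distance to that
   column. *)
have a_up t : (t <= k)%N -> forall i, (i < k - t)%N -> a i (k - t)%N = 0.
  elim: t => [|t IHt] le_tk i; first by rewrite subn0; apply: a_last.
  move=> lt_i; have lt_kt : (k - t.+1 < k)%N by rewrite ltn_subrL (leq_trans _ le_tk).
  apply/eqP; rewrite -(frobenius_pow_eq0 s) -a_shift ?(ltn_trans lt_i) //.
  have Dkt : (k - t.+1).+1 = (k - t)%N by rewrite subnSK.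
  by rewrite Dkt (IHt (ltnW le_tk)) // -Dkt.
have a_diag i : (i <= k)%N -> a i i = sigma (s * i) (a 0%N 0%N).
  elim: i => [|i IHi] lt_ik; first by rewrite muln0 /frobenius_pow expr1.
  by rewrite a_shift // IHi 1?ltnW // frobenius_pow_comp addnC -mulnS.
exists (a 0%N 0%N); apply/matrixP => i j; rewrite !mxE.
have -> : A i j = a i j by rewrite /a !inord_val.
have ik : (i <= k)%N := ltn_ord i; have jk : (j <= k)%N := ltn_ord j.
case: eqVneq => [->|neq_ij]; first by rewrite a_diag.
rewrite mulr0n; move: neq_ij; rewrite -val_eqE /=.
case: ltngtP => // [lt_ij|lt_ji] _; last exact: a_low.
by rewrite -(subKn jk) a_up ?leq_subr // subKn.
Qed.

Lemma diag_gabidulin_system k (S : {vspace L}) (d : L) :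
  [set diag_mx (\row_(i < k) d ^+ (#|F| ^ (s * i))) *m u
     | u in gabidulin_system k s S] =
  gabidulin_system k s (amull d @: S)%VS.
Proof.
have diagM x : diag_mx (\row_(i < k) d ^+ (#|F| ^ (s * i))) *m gabidulin_vec k s x =
               gabidulin_vec k s (d * x).
  by apply/colP => i; rewrite mul_diag_mx !mxE exprMn.
apply/seteqP; split => [_ [_ [x /= Sx <-] <-]|_ [_ /memv_imgP[x Sx ->] <-]].
  rewrite diagM; exists (d * x) => //=.
  by apply/memv_imgP; exists x; rewrite ?lfunE.
exists (gabidulin_vec k s x); first by exists x.
by rewrite diagM lfunE.
Qed.

(** Coordinate 0 of a vector is [x] itself, since its exponent is [q ^ 0 = 1]. *)
Lemma gabidulin_system_inj k : (0 < k)%N ->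
  injective (@gabidulin_system F L k s).
Proof.
case: k => // k _.
have sub (S T : {vspace L}) :
    gabidulin_system k.+1 s S = gabidulin_system k.+1 s T -> (S <= T)%VS.
  move=> eqST; apply/subvP => x Sx.
  have [y /= Ty /colP/(_ 0)] : gabidulin_system k.+1 s T (gabidulin_vec k.+1 s x).
    by rewrite -eqST; exists x.
  by rewrite !mxE muln0 !expr1 => <-.
by move=> S T eqST; apply/eqP; rewrite eqEsubv !sub.
Qed.

Lemma diag_frobenius_unitmx k (d : L) : (0 < k)%N ->
  (diag_mx (\row_(i < k) d ^+ (#|F| ^ (s * i))) \in unitmx) = (d != 0).
Proof.
move=> k_gt0; rewrite unitmxE det_diag unitfE; apply/idP/idP => [|d_neq0].
  apply: contraNneq => ->; rewrite (bigD1 (Ordinal k_gt0)) //= mxE.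
  by rewrite muln0 expr1 mul0r.
by apply/prodf_neq0 => i _; rewrite mxE expf_neq0.
Qed.

Lemma gabidulin_image_diag k (S T : {vspace L}) (A : 'M[L]_k) :
  (k < \dim S)%N ->
  [set A *m u | u in gabidulin_system k s S] = gabidulin_system k s T ->
  exists d, A = diag_mx (\row_(i < k) d ^+ (#|F| ^ (s * i))).
Proof.
move=> dimS AST; apply: (gabidulin_map_diag dimS) => x Sx.
have [y _ <-] : gabidulin_system k s T (A *m gabidulin_vec k s x); last by exists y.
by rewrite -AST; exists (gabidulin_vec k s x) => //; exists x.
Qed.

End GabidulinSystems.

Theorem theorem4p3 (F : finFieldType) (L : fieldExtType F) (k s : nat)
    (hk : (0 < k)%N) (hs : (1 <= s <= \dim {:L})%N)
    (hsm : coprime s (\dim {:L})) :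
  (forall S T : {vspace L},
     \dim S = \dim T -> (k < \dim S)%N ->
     (system_equiv (gabidulin_system k s S) (gabidulin_system k s T) <->
      exists alpha : L, alpha != 0 /\ T = (amull alpha @: S)%VS)) /\
  ((k < \dim {:L})%N ->
     system_stab (gabidulin_system k s {:L}%VS) =
     [set diag_mx (\row_(i < k) d ^+ (#|F| ^ (s * i))) | d in [set d : L | d != 0]]).
Proof.
split=> [S T _ dimS|dimL].
  split=> [[A unitA AST]|[d [d_neq0 ->]]].
    have [d defA] := gabidulin_image_diag hsm dimS AST; exists d; split.
      by rewrite -(diag_frobenius_unitmx s d hk) -defA.
    (* The image under [A] is the system of [T] and also that of [d S]. *)
    by apply: (gabidulin_system_inj (s := s) hk); rewrite -AST defA diag_gabidulin_system.
  exists (diag_mx (\row_(i < k) d ^+ (#|F| ^ (s * i)))).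
    by rewrite diag_frobenius_unitmx.
  exact: diag_gabidulin_system.
apply/seteqP; split=> [A [unitA AL]|_ [d /= d_neq0 <-]].
  have [d defA] := gabidulin_image_diag hsm dimL AL; exists d => //=.
  by rewrite -(diag_frobenius_unitmx s d hk) -defA.
split; first by rewrite diag_frobenius_unitmx.
(* Multiplication by [d != 0] is injective, hence maps [L] onto itself. *)
by rewrite diag_gabidulin_system lker0_limgf // lker0_amull ?unitfE.
Qed.
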